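(* Let $H$ be a connected hypergraph with $r(H)=k$. Then $$\rho(\mathcal{A}_H)\leqslant\max\left\{\sqrt[k]{d_{i_1}^{\,k-s+1}d_{i_2}\cdots d_{i_s}}\ \Big|\ \{i_1,\ldots,i_s\}\in E(H),\ d_{i_1}\geqslant\cdots\geqslant d_{i_s}\right\},$$ where the maximum is over all edges of $H$, $s$ denotes the cardinality of the edge $\{i_1,\ldots,i_s\}$, and $d_i$ is the degree of vertex $i$.
   Context: A (finite) hypergraph $H$ has vertex set $V(H)$ and edge set $E(H)$, a set of nonempty subsets of $V(H)$, with at least one edge (so that the rank is defined). The degree $d_i$ of a vertex $i$ is the number of edges containing $i$. The rank $r(H)$ is the maximum cardinality of an edge. A path of length $l$ is an alternating sequence $u_1e_1u_2\cdots u_le_lu_{l+1}$ with distinct vertices $u_1,\ldots,u_{l+1}$ and distinct edges $e_1,\ldots,e_l$ such that $u_i,u_{i+1}\in e_i$ for all $i$; $H$ is connected if there is a path between any two vertices. The adjacency tensor $\mathcal{A}_H=(a_{i_1\cdots i_k})$ of a hypergraph $H$ with $r(H)=k$ is the order $k$, dimension $|V(H)|$ symmetric tensor with $a_{i_1\cdots i_k}=\frac{1}{(k-1)!}$ if $\{i_1,\ldots,i_k\}$ is an edge of cardinality $k$; $a_{i_1\cdots i_k}=\frac{(k-s+1)!}{k!}$ if, as a multiset, $\{i_1,\ldots,i_k\}$ consists of $j_1$ with multiplicity $k-s+1$ and $j_2,\ldots,j_s$ each with multiplicity one, for some edge $\{j_1,\ldots,j_s\}\in E(H)$ of cardinality $s<k$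 (any element of the edge may play the role of $j_1$); and $a_{i_1\cdots i_k}=0$ otherwise. For an order $m$ dimension $n$ tensor $\mathcal{A}=(a_{i_1\cdots i_m})$ and $x\in\mathbb{C}^n$, $\mathcal{A}x^{m-1}\in\mathbb{C}^n$ has $i$-th component $\sum_{i_2,\ldots,i_m=1}^n a_{ii_2\cdots i_m}x_{i_2}\cdots x_{i_m}$. A number $\lambda\in\mathbb{C}$ is an eigenvalue of $\mathcal{A}$ if $\mathcal{A}x^{m-1}=\lambda x^{[m-1]}$ for some nonzero $x\in\mathbb{C}^n$, where $x^{[m-1]}=(x_1^{m-1},\ldots,x_n^{m-1})^{\mathrm T}$. The spectral radius is $\rho(\mathcal{A})=\max\{|\lambda|:\lambda \text{ an eigenvalue of }\mathcal{A}\}$. *)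

(* Defs.v *)
From HB Require Import structures.
From mathcomp Require Import all_boot all_order all_algebra.
From mathcomp Require Import boolp classical_sets reals ereal exp.
From mathcomp Require Import complex.

Set Implicit Arguments.
Unset Strict Implicit.
Unset Printing Implicit Defensive.

Import Order.TTheory GRing.Theory Num.Theory.

Local Open Scope ring_scope.

(* The vertex set is the whole of the finite type [V]. *)
Record hypergraph (V : finType) := Hypergraph {
  edges : {set {set V}};
  edges_neq0 : edges != finset.set0;
  edge_neq0 : finset.set0 \notin edges
}.

Section Hypergraphs.
Variables (V : finType) (H : hypergraph V).
Local Open Scope nat_scope.

Definition degree (v : V) : nat := #|[set e in edges H | v \in e]|.

Definition rank : nat := \max_(e in edges H) #|e|.

(* The path u_1 e_1 u_2 ... e_l u_(l+1) is given by its first vertex [u] = u_1,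
   [us] = u_2, ..., u_(l+1) and [es] = e_1, ..., e_l; the pairs in
   [zip (u :: us) us] are (u_i, u_(i+1)), and [all2] forces
   [size us = size es]. *)
Definition is_hpath (u : V) (us : seq V) (es : seq {set V}) : bool :=
  [&& uniq (u :: us), uniq es, all (fun e => e \in edges H) es
    & all2 (fun (p : V * V) (e : {set V}) => (p.1 \in e) && (p.2 \in e))
         (zip (u :: us) us) es].

Definition hconnected : Prop :=
  forall u v : V, exists us es, is_hpath u us es /\ last u us = v.

(* d_(i_1) >= ... >= d_(i_s) for e = {i_1, ..., i_s} *)
Definition edge_degrees (e : {set V}) : seq nat :=
  sort geq [seq degree v | v <- enum e].

(* d_(i_1) ^ (k - s + 1) * d_(i_2) * ... * d_(i_s), with s = #|e| <= k *)
Definition edge_weight (k : nat) (e : {set V}) : nat :=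
  head 0 (edge_degrees e) ^ (k - #|e| + 1)
  * \prod_(d <- behead (edge_degrees e)) d.

End Hypergraphs.

(* Tensors of order [m] whose indices range over the finite type [I]. *)
Definition tensor (K : Type) (I : finType) (m : nat) := m.-tuple I -> K.

Section Tensors.
Variables (K : fieldType) (I : finType) (m : nat) (A : tensor K I m).

(* Summing over the tuples t = (i_1, ..., i_m) with i_1 = i avoids writing
   the order as a successor. *)
Definition tensor_apply (x : I -> K) (i : I) : K :=
  \sum_(t : m.-tuple I | ohead t == Some i)
     A t * \prod_(j <- behead t) x j.

Definition tensor_eigenvalue (lambda : K) : Prop :=
  exists2 x : {ffun I -> K}, x != 0 &
    forall i, tensor_apply x i = lambda * x i ^+ m.-1.

End Tensors.

(* The supremum is taken in [\bar R], so that it is not given a default value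
   should the set of moduli be unbounded or empty. *)
Definition spectral_radius (R : realType) (I : finType) (m : nat)
    (A : tensor R[i] I m) : \bar R :=
  ereal_sup [set (Normc.normc lambda)%:E | lambda in tensor_eigenvalue A]%classic.

Lemma spectral_radius_max (R : realType) (I : finType) (m : nat)
    (A : tensor R[i] I m) (lambda : R[i]) :
  tensor_eigenvalue A lambda ->
  (forall mu, tensor_eigenvalue A mu ->
     Normc.normc mu <= Normc.normc lambda) ->
  spectral_radius A = (Normc.normc lambda)%:E.
Proof.
move=> Al Amax; apply/eqP; rewrite eq_le; apply/andP; split.
  by apply: ge_ereal_sup => _ [mu Amu <-]; rewrite lee_fin; exact: Amax.
by apply: ereal_sup_ubound; exists lambda.
Qed.

(* The support of the tuple [t] as a set is the only edge that can contribute
   to the entry at [t]. *)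
Definition adjacency_tensor (K : fieldType) (V : finType) (H : hypergraph V) :
    tensor K V (rank H) := fun t =>
  let k := rank H in
  let e := [set v in t] in
  let s := #|e| in
  if e \notin edges H then 0
  else if s == k then (k.-1`!)%:R^-1
  else if [exists j1 in e, [forall v in e,
             count_mem v t == if v == j1 then (k - s + 1)%N else 1%N]]
  then ((k - s + 1)`!)%:R / (k`!)%:R
  else 0.

Arguments adjacency_tensor K {V} H t.

(* Main.v *)
Require Import Defs.
From mathcomp Require Import all_boot all_order all_algebra.
From mathcomp Require Import reals ereal exp complex.

Set Implicit Arguments.
Unset Strict Implicit.
Unset Printing Implicit Defensive.

Import Order.TTheory GRing.Theory Num.Theory.
Local Open Scope ring_scope.

(** Let [lambda] be an eigenvalue with eigenvector [x], and put [mu = |lambda|],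
    [y_i = |x_i|].  The triangle inequality gives
    [mu * y_i ^ k <= \sum_t a_t * y_(t_1) * ... * y_(t_k)], the sum being over the
    index tuples [t] that start with [i].  Two facts about the adjacency tensor
    are needed: it is nonnegative, and its [i]-th row sum is at most the degree
    [d_i] ([adjacency_tensor_row_le]).

    Let [M] be the largest value of [y_(t_1) * ... * y_(t_k)] over the tuples with
    [a_t != 0], attained at [u].  Then [mu * y_i ^ k <= d_i * M] for every [i].
    Multiplying these inequalities for [i = u_1, ..., u_k] gives
    [mu ^ k * M ^ k <= d_(u_1) * ... * d_(u_k) * M ^ k], and [M > 0] as soon as
    [mu > 0], so [mu ^ k <= d_(u_1) * ... * d_(u_k)]
    ([subeigenvalue_le_prod]).  Since [a_u != 0], the tuple [u] lists the vertices
    of an edge [e], one of them [k - #|e| + 1] times; replacing the repeated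
    vertex by one of largest degree in [e] turns the right-hand side into the
    weight of [e] ([prod_degree_edge_word]).

    The row sum is a count.  An edge [e] of size [s] containing [i] contributes
    [(k - s + 1)! / k!] for every pair of a tuple and a vertex [j] of [e], where
    the tuple starts with [i] and repeats exactly [j].  Such pairs inject into the
    injections from [e] minus [i] to the [k] positions ([card_edge_words]), and
    there are [k! / (k - s + 1)!] of these, so [e] contributes at most 1. *)

(** * A bound for nonnegative tensors with bounded row sums *)

(** The maximal monomial [w t] is raised to the power [m] on both sides, once as
    the product of the [y_j ^ m] and once as [m] copies of the common bound, and
    cancels. *)
Lemma subeigenvalue_le_prod (F : realFieldType) (I : finType) (m : nat)
    (A : tensor F I m) (d y : I -> F) (mu : F) :
  (0 < m)%N -> (forall t, 0 <= A t) ->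
  (forall i, \sum_(t : m.-tuple I | ohead t == Some i) A t <= d i) ->
  (forall i, 0 <= y i) -> (exists i, y i != 0) -> 0 < mu ->
  (forall i, mu * y i ^+ m.-1 <= tensor_apply A y i) ->
  exists2 t, A t != 0 & mu ^+ m <= \prod_(j <- t) d j.
Proof.
move=> m_gt0 A_ge0 rowA y_ge0 [i0 yi0] mu_gt0 eigA.
pose w (t : m.-tuple I) := \prod_(j <- t) y j.
have row_w i : mu * y i ^+ m <= \sum_(t : m.-tuple I | ohead t == Some i) A t * w t.
  have := ler_wpM2l (y_ge0 i) (eigA i).
  rewrite mulrCA -exprS prednK // => /le_trans; apply.
  rewrite mulr_sumr ler_sum // => t /eqP t_i.
  rewrite mulrCA ler_wpM2l // /w.
  by case: t t_i => -[|a s] //= _ [->]; rewrite big_cons.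
have row_pos : 0 < \sum_(t : m.-tuple I | ohead t == Some i0) A t * w t.
  by apply: lt_le_trans (row_w i0); rewrite mulr_gt0 // exprn_gt0 // lt0r yi0 y_ge0.
(* An eigenvector inequality with [mu > 0] forces a nonzero entry, so that the
   maximum below is over a nonempty set. *)
have [t0 At0] : exists t, A t != 0.
  apply/existsP; apply: contraLR row_pos; rewrite negb_exists => /forallP A0.
  by rewrite big1 ?ltxx // => t _; move/negPn/eqP: (A0 t) => ->; rewrite mul0r.
have [t At t_max] := @arg_maxP _ _ _ t0 (fun t => A t != 0) w At0.
have w_ge0 : 0 <= w t by apply: prodr_ge0 => j _.
have row_max i : mu * y i ^+ m <= d i * w t.
  apply: le_trans (row_w i) _; apply: le_trans (ler_wpM2r w_ge0 (rowA i)).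
  rewrite mulr_suml ler_sum // => u _; case: (eqVneq (A u) 0) => [->|Au].
    by rewrite !mul0r.
  by rewrite ler_wpM2l //; exact: t_max.
have w_gt0 : 0 < w t.
  rewrite lt0r w_ge0 andbT; apply: contraTneq (row_max i0) => ->.
  by rewrite mulr0 -ltNge mulr_gt0 // exprn_gt0 // lt0r yi0 y_ge0.
exists t => //; rewrite -(ler_pM2r (exprn_gt0 m w_gt0)).
have -> : mu ^+ m * w t ^+ m = \prod_(j <- t) (mu * y j ^+ m).
  rewrite big_split /= prodrXl; congr (_ * _).
  by rewrite big_const_seq count_predT size_tuple iter_mulr_1.
have -> : (\prod_(j <- t) d j) * w t ^+ m = \prod_(j <- t) (d j * w t).
  by rewrite big_split /= big_const_seq count_predT size_tuple iter_mulr_1.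
by apply: ler_prod => j _; rewrite row_max mulr_ge0 ?exprn_ge0 // ltW.
Qed.

(** * Words of an edge and their number *)

Lemma index_count1 (T : eqType) (x0 : T) (s : seq T) (p : nat) :
  (p < size s)%N -> count_mem (nth x0 s p) s = 1%N -> index (nth x0 s p) s = p.
Proof.
elim: s p => [|a s IHs] [|p] //=; first by rewrite eqxx.
rewrite ltnS => p_s; have := mem_nth x0 p_s; rewrite -has_pred1 has_count.
case: eqP => /= [_|_] cnt_gt0.
  by rewrite add1n => -[cnt0]; rewrite cnt0 in cnt_gt0.
by rewrite add0n => /(IHs _ p_s) ->.
Qed.

Section EdgeWords.
Variable V : finType.
Implicit Types (e : {set V}) (i j v : V).

(** [t] lists the vertices of [e], and [j] absorbs the whole excess of the length
    [k] over the cardinality of [e].  When [#|e| = k] no vertex is repeated, and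
    every [j] in [e] qualifies; this makes edges of maximal and of smaller
    cardinality instances of one formula in [adjacency_tensorE]. *)
Definition edge_word (k : nat) e j (t : seq V) : bool :=
  [&& [set v in t] == e, j \in e &
      [forall v in e, count_mem v t == if v == j then (k - #|e| + 1)%N else 1%N]].

Lemma edge_word_count k e j t v : edge_word k e j t -> v \in e ->
  count_mem v t = if v == j then (k - #|e| + 1)%N else 1%N.
Proof. by case/and3P=> _ _ /forall_inP cnt /cnt/eqP. Qed.

Lemma edge_word_mem k e j t v : edge_word k e j t -> (v \in t) = (v \in e).
Proof. by case/and3P=> /eqP <- _ _; rewrite inE. Qed.

(** A word is recovered from the positions of its unrepeated vertices: [j]
    occupies all the others. *)
Lemma edge_word_index_inj k e j (t t' : k.-tuple V) :
  edge_word k e j t -> edge_word k e j t' ->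
  {in e :\ j, forall v, index v t = index v t'} -> t = t'.
Proof.
move=> wt wt' eq_ix.
(* This step is symmetric in [t] and [t'] and is used in both directions. *)
have transfer (s s' : k.-tuple V) : edge_word k e j s -> edge_word k e j s' ->
    {in e :\ j, forall v, index v s = index v s'} ->
    forall p, (p < k)%N -> nth j s p != j -> nth j s' p = nth j s p.
  move=> ws ws' eq_s p p_k; set v := nth j s p => v_j.
  have v_s : v \in val s by rewrite mem_nth ?size_tuple.
  have v_e : v \in e by rewrite -(edge_word_mem _ ws).
  have ix_v : index v s = p.
    rewrite /v index_count1 ?size_tuple //.
    by rewrite (edge_word_count ws v_e) (negPf v_j).
  have v_s' : v \in val s' by rewrite (edge_word_mem _ ws').
  by rewrite -[in LHS]ix_v eq_s ?nth_index // in_setD1 v_j.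
apply/val_inj/(@eq_from_nth _ j); first by rewrite !size_tuple.
rewrite size_tuple => p p_k.
case: (eqVneq (nth j t p) j) => [tp_j|/(transfer _ _ wt wt' eq_ix _ p_k) //].
case: (eqVneq (nth j t' p) j) => [->//|].
by apply: (transfer _ _ wt' wt) => // v /eq_ix.
Qed.

(** Send [(t, j)] to the map that takes a vertex [v != i] of [e] to its position
    in [t], except that [j] goes to position 0.  That position is occupied by [i],
    hence free for this use, and the map stays injective.  It determines [j], as
    the vertex sent to 0 or [i] if there is none, and then
    [edge_word_index_inj] recovers [t]. *)
Lemma card_edge_words k e i : (0 < k)%N -> i \in e ->
  (#|[set p : k.-tuple V * V |
        (ohead p.1 == Some i) && edge_word k e p.2 p.1]| <= k ^_ #|e|.-1)%N.
Proof.
case: k => // n _ i_e; set W := [set p | _].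
pose U := {v : V | v \in e :\ i}.
pose pos (p : n.+1.-tuple V * V) : {ffun U -> 'I_n.+1} :=
  [ffun u => if val u == p.2 then ord0 else inord (index (val u) p.1)].
have card_U : #|{: U}| = #|e|.-1 by rewrite card_sig [#|e|](cardsD1 i) i_e.
have posE (t : n.+1.-tuple V) j v : edge_word n.+1 e j t -> forall v_ei : v \in e :\ i,
    pos (t, j) (exist _ v v_ei) = (if v == j then 0 else index v t)%N :> nat.
  move=> wt v_ei; rewrite ffunE /=; case: eqP => // _; rewrite inordK //.
  rewrite -[X in (_ < X)%N](size_tuple t) index_mem (edge_word_mem _ wt).
  by case/setD1P: v_ei.
have ix0 (t : n.+1.-tuple V) v : ohead t = Some i -> index v t = 0%N -> v = i.
  by case: t => -[|a s] //= _ [->]; case: eqP.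
have head0 (t : n.+1.-tuple V) : ohead t = Some i -> index i t = 0%N.
  by case: t => -[|a s] //= _ [->]; rewrite eqxx.
have eq_pos (t : n.+1.-tuple V) j (t' : n.+1.-tuple V) j' :
    edge_word n.+1 e j t -> edge_word n.+1 e j' t' ->
    pos (t, j) = pos (t', j') -> forall v, v \in e :\ i ->
    (if v == j then 0 else index v t)%N = (if v == j' then 0 else index v t')%N.
  move=> wt wt' eq_p v v_ei.
  by rewrite -(posE t j v wt v_ei) -(posE t' j' v wt' v_ei) eq_p.
have same_j (t : n.+1.-tuple V) j (t' : n.+1.-tuple V) j' :
    ohead t = Some i -> ohead t' = Some i ->
    edge_word n.+1 e j t -> edge_word n.+1 e j' t' ->
    pos (t, j) = pos (t', j') -> j != i -> j = j'.
  move=> ht ht' wt wt' /(eq_pos _ _ _ _ wt wt') eq_p j_i.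
  have j_e : j \in e by case/and3P: wt.
  have := eq_p j; rewrite in_setD1 j_i j_e eqxx => /(_ isT).
  by case: eqP => // _ /esym/(ix0 _ _ ht') ji; rewrite ji eqxx in j_i.
have pos_inj : {in W &, injective pos}.
  move=> [t j] [t' j']; rewrite !inE /=.
  move=> /andP[/eqP ht wt] /andP[/eqP ht' wt'] eq_p.
  have jj : j = j'.
    case: (eqVneq j i) => [ji|]; last exact: same_j ht ht' wt wt' eq_p.
    case: (eqVneq j' i) => [->//|/(same_j _ _ _ _ ht' ht wt' wt (esym eq_p)) ->//].
  subst j'; congr (_, _); apply: (edge_word_index_inj wt wt') => v.
  rewrite in_setD1 => /andP[v_j v_e].
  case: (eqVneq v i) => [->|v_i]; first by rewrite !head0.
  have := eq_pos _ _ _ _ wt wt' eq_p v.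
  by rewrite in_setD1 v_i v_e (negPf v_j) => /(_ isT).
rewrite -(card_in_imset pos_inj) -card_U -[in X in (_ <= X)%N](card_ord n.+1).
rewrite -card_inj_ffuns; apply/subset_leq_card/subsetP => f /imsetP[[t j] Wtj ->].
move: Wtj; rewrite !inE /= => /andP[/eqP ht wt].
apply/injectiveP => -[v v_ei] [v' v_ei'] /(congr1 val) /=.
rewrite !posE // => eq_v; apply: val_inj => /=.
have [[v_i v_e] [v_i' v_e']] := (setD1P v_ei, setD1P v_ei').
move: eq_v; case: eqP => [->|_]; case: eqP => [->|_] //.
- by move/esym/(ix0 _ _ ht)=> vi; rewrite vi eqxx in v_i'.
- by move/(ix0 _ _ ht)=> vi; rewrite vi eqxx in v_i.
- move/(congr1 (nth v t)); rewrite nth_index ?(edge_word_mem _ wt) //.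
  by rewrite nth_index ?(edge_word_mem _ wt).
Qed.

(** * The entries and row sums of the adjacency tensor *)

Variable H : hypergraph V.
Let k := rank H.

Lemma card_edge_le_rank e : e \in edges H -> (#|e| <= k)%N.
Proof. exact: (@leq_bigmax_cond _ (fun e => e \in edges H) (fun e => #|e|)). Qed.

Lemma card_edge_gt0 e : e \in edges H -> (0 < #|e|)%N.
Proof.
by move=> eH; rewrite card_gt0; apply: contraNneq (edge_neq0 H) => <-.
Qed.

Lemma rank_gt0 : (0 < k)%N.
Proof.
have /set0Pn[e eH] := edges_neq0 H.
exact: leq_trans (card_edge_gt0 eH) (card_edge_le_rank eH).
Qed.

(** Only the support of [t] contributes to the outer sum.  If it has fewer than
    [k] elements, at most one [j] makes [t] a word, since such a [j] occurs at
    least twice and the other vertices once; if it has [k] elements, each of them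
    qualifies, and [k * (1! / k!) = 1 / (k - 1)!]. *)
Lemma adjacency_tensorE (F : numFieldType) (t : k.-tuple V) :
  adjacency_tensor F H t = \sum_(e in edges H) \sum_(j | edge_word k e j t)
    ((k - #|e| + 1)`!)%:R / (k`!)%:R.
Proof.
set e := [set v in t].
have other_edges e' : e' != e -> forall j, edge_word k e' j t = false.
  by move=> ne j; rewrite /edge_word eq_sym (negPf ne).
rewrite /adjacency_tensor -/e -/k; case: ifPn => [eH|/negPn eH].
  rewrite big1 // => e' e'H; rewrite big_pred0 //; apply: other_edges.
  by apply: contraNneq eH => <-.
rewrite (bigD1 e) //= [X in _ = _ + X]big1 ?addr0; last first.
  by move=> e' /andP[_ ne]; rewrite big_pred0 //; exact: other_edges.
case: eqP => [card_e|/eqP card_e].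
  have /card_uniqP uniq_t : #|t| = size t
    by rewrite size_tuple -[RHS]card_e cardsE.
  rewrite (eq_bigl (mem e)) => [|j]; last first.
    rewrite /edge_word eqxx /=; case: (j \in e) => //=.
    apply/forall_inP => v; rewrite inE => v_t.
    by rewrite count_uniq_mem // v_t card_e subnn if_same.
  rewrite sumr_const card_e subnn add0n -[RHS]mulr_natl [1`!%:R / _]div1r.
  rewrite -[in RHS](prednK rank_gt0) factS natrM invfM mulVKf // pnatr_eq0.
case: ifPn => [/exists_inP[j je cnt]|noj].
  have wj : edge_word k e j t by rewrite /edge_word eqxx je.
  rewrite (big_pred1 j) // => j'; apply/idP/eqP => [wj'|->//].
  apply/eqP; apply: contraNT card_e => jj'.
  have := edge_word_count wj je; rewrite (edge_word_count wj' je) eqxx.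
  rewrite eq_sym (negPf jj') addn1 => -[/esym/eqP].
  by rewrite subn_eq0 eqn_leq (card_edge_le_rank eH) => ->.
rewrite big_pred0 // => j; apply: contraNF noj => /and3P[_ je cnt].
by apply/exists_inP; exists j.
Qed.

Lemma adjacency_tensor_ge0 (F : numFieldType) (t : k.-tuple V) :
  0 <= adjacency_tensor F H t.
Proof.
by rewrite adjacency_tensorE; do 2!apply: sumr_ge0 => ? _; rewrite divr_ge0.
Qed.

Lemma adjacency_tensor_neq0 (F : numFieldType) (t : k.-tuple V) :
  adjacency_tensor F H t != 0 ->
  exists e, e \in edges H /\ exists j, edge_word k e j t.
Proof.
rewrite adjacency_tensorE => sum_neq0.
suff /exists_inP[e eH /existsP w] : [exists e in edges H, exists j, edge_word k e j t].
  by exists e.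
apply: contraNT sum_neq0; rewrite negb_exists_in => /forall_inP nw.
rewrite big1 // => e /nw; rewrite negb_exists => /forallP nwe.
by rewrite big_pred0 // => j; apply/negbTE.
Qed.

(** Each edge through [i] contributes at most 1, the count of
    [card_edge_words] being [k! / (k - s + 1)!] for an edge of size [s]; the other
    edges have no word starting with [i]. *)
Lemma adjacency_tensor_row_le (F : numFieldType) i :
  \sum_(t : k.-tuple V | ohead t == Some i) adjacency_tensor F H t
  <= (degree H i)%:R.
Proof.
under eq_bigr do rewrite adjacency_tensorE.
rewrite exchange_big /= /degree cardsE -sum1_card natr_sum big_mkcondr /=.
apply: ler_sum => e eH; rewrite pair_big_dep /= sumr_const.
case: ifPn => [i_e|i_e]; last first.
  rewrite -[X in _ *+ X](_ : 0%N = _) ?mulr0n //.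
  apply/esym/eq_card0 => -[t j]; rewrite !inE; apply/negP => /= /andP[/eqP ht wt].
  case/negP: i_e; rewrite -(edge_word_mem _ wt).
  by case: t ht {wt} => -[|a s] //= _ [->]; rewrite mem_head.
have card_W := card_edge_words rank_gt0 i_e; rewrite cardsE in card_W.
have fact_k : (k ^_ #|e|.-1 * (k - #|e| + 1)`! = k`!)%N.
  have [e_gt0 e_k] := (card_edge_gt0 eH, card_edge_le_rank eH).
  rewrite -(@ffact_fact k #|e|.-1) ?(leq_trans (leq_pred _)) //.
  by congr (_ * _`!)%N; rewrite -subn1 subnBA // addnBAC.
rewrite -[leLHS]mulr_natl mulrA ler_pdivrMr ?ltr0n ?fact_gt0 // mul1r -natrM ler_nat.
by rewrite -fact_k leq_mul2r card_W orbT.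
Qed.

Lemma degree_le_head e j : j \in e -> (degree H j <= head 0 (edge_degrees H e))%N.
Proof.
move=> j_e; have : degree H j \in edge_degrees H e.
  by rewrite mem_sort map_f // mem_enum.
have : sorted geq (edge_degrees H e) by apply: sort_sorted => a b; exact: leq_total.
case: (edge_degrees H e) => //= a s a_s; rewrite in_cons => /predU1P[->//|].
apply/allP: (degree H j); apply: order_path_min a_s => x y z xy yz.
exact: leq_trans yz xy.
Qed.

(** The word contributes each degree in [e] once and that of [j] another
    [k - #|e|] times, where the weight repeats the largest degree instead. *)
Lemma prod_degree_edge_word e j t : e \in edges H -> edge_word k e j t ->
  (\prod_(v <- t) degree H v <= edge_weight H k e)%N.
Proof.
move=> eH wt; have /and3P[/eqP t_e j_e _] := wt.
have -> : (\prod_(v <- t) degree H v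
           = degree H j ^ (k - #|e|) * \prod_(v in e) degree H v)%N.
  rewrite [LHS](_ : _ = \prod_(v in e) degree H v ^ count_mem v t)%N; last first.
    rewrite -big_undup_iterop_count -big_enum /=.
    apply/perm_big/uniq_perm; rewrite ?undup_uniq ?enum_uniq // => v.
    by rewrite mem_undup mem_enum (edge_word_mem _ wt).
  rewrite (bigD1 j) //= [in RHS](bigD1 j) //= mulnA -expnSr.
  rewrite (edge_word_count wt j_e) eqxx addn1; congr (_ * _)%N.
  apply: eq_bigr => v /andP[v_e v_j].
  by rewrite (edge_word_count wt v_e) (negPf v_j) expn1.
have -> : (\prod_(v in e) degree H v = \prod_(d <- edge_degrees H e) d)%N.
  by rewrite (perm_big _ (permEl (perm_sort _ _))) big_map big_enum.
have := degree_le_head j_e; rewrite /edge_weight.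
have : size (edge_degrees H e) = #|e| by rewrite size_sort size_map cardE.
case: (edge_degrees H e) => [|a s] /=.
  by move=> e0; have := card_edge_gt0 eH; rewrite -e0.
move=> _ j_a; rewrite big_cons mulnA addn1 expnSr.
rewrite !leq_mul2r; do 2!(apply/orP; right).
by case: (k - #|e|)%N => // n; rewrite leq_exp2r.
Qed.

End EdgeWords.

(** * From complex eigenvalues to real inequalities *)

Section Complex.
Variable R : realType.
Local Open Scope complex_scope.

(** The norm of [R[i]] takes its values in [R[i]] itself; the modulus in
    [spectral_radius] is the real number that it embeds. *)
Lemma complex_normc (z : R[i]) : (Normc.normc z)%:C = `|z|.
Proof. by []. Qed.

(** The triangle inequality: the moduli of an eigenvector satisfy the eigenvalue
    equation of the tensor of moduli as an inequality. *)
Lemma tensor_eigenvalue_normc (I : finType) (m : nat) (A : tensor R[i] I m)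
    (B : tensor R I m) (lambda : R[i]) :
  (forall t, `|A t| = (B t)%:C) -> tensor_eigenvalue A lambda ->
  exists2 y : I -> R, (forall i, 0 <= y i) /\ (exists i, y i != 0) &
    forall i, Normc.normc lambda * y i ^+ m.-1 <= tensor_apply B y i.
Proof.
move=> normA [x x_neq0 eigx]; pose y i := Normc.normc (x i).
have yC i : (y i)%:C = `|x i| by exact: complex_normc.
exists y; [split=> [i|]|move=> i].
- by rewrite -ler0c yC normr_ge0.
- have /existsP[i xi] : [exists i, x i != 0].
    apply: contraNT x_neq0; rewrite negb_exists => /forallP x0.
    by apply/eqP/ffunP => i; rewrite ffunE; apply/eqP; rewrite -[_ == _]negbK.
  by exists i; rewrite -(inj_eq (@complexI R)) yC normr_eq0.
have -> : Normc.normc lambda * y i ^+ m.-1 = Normc.normc (lambda * x i ^+ m.-1).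
  apply: complexI; rewrite rmorphM rmorphXn [in RHS]complex_normc.
  by rewrite normrM normrX.
rewrite -eigx -lecR complex_normc.
apply: le_trans (ler_norm_sum _ _ _) _.
rewrite /tensor_apply rmorph_sum ler_sum // => t _.
rewrite normrM normA rmorphM normr_prod rmorph_prod.
exact: lexx.
Qed.

Lemma norm_adjacency_tensor (V : finType) (H : hypergraph V) t :
  `|adjacency_tensor R[i] H t| = (adjacency_tensor R H t)%:C.
Proof.
rewrite ger0_norm ?adjacency_tensor_ge0 // !adjacency_tensorE rmorph_sum.
apply: eq_bigr => e _; rewrite rmorph_sum; apply: eq_bigr => j _.
by rewrite fmorph_div !rmorph_nat.
Qed.

End Complex.

Theorem theorem3p5 (R : realType) (V : finType) (H : hypergraph V) (k : nat)
    (rankH : rank H = k) (connH : hconnected H) :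
  (spectral_radius (adjacency_tensor R[i] H)
   <= (\big[Num.max/0%R]_(e in edges H)
         powR ((edge_weight H k e)%:R : R) (k%:R^-1))%:E)%E.
Proof.
subst k; apply: ge_ereal_sup => _ [lambda eigl <-]; rewrite lee_fin.
set mu := Normc.normc lambda.
have mu_ge0 : 0 <= mu by rewrite -ler0c complex_normc normr_ge0.
have [y [y_ge0 y_neq0] suby] :=
  tensor_eigenvalue_normc (@norm_adjacency_tensor R V H) eigl.
case: (eqVneq mu 0) => [->|mu_neq0]; first exact: bigmax_ge_id.
have mu_gt0 : 0 < mu by rewrite lt0r mu_neq0.
have [t /adjacency_tensor_neq0[e [eH [j wt]]] mu_le] :=
  subeigenvalue_le_prod (rank_gt0 H) (@adjacency_tensor_ge0 _ H R)
    (@adjacency_tensor_row_le _ H R) y_ge0 y_neq0 mu_gt0 suby.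
apply: le_trans (le_bigmax_cond _ _ eH).
have mu_w : mu ^+ rank H <= (edge_weight H (rank H) e)%:R.
  by apply: le_trans mu_le _; rewrite -natr_prod ler_nat (prod_degree_edge_word eH wt).
have k_neq0 : (rank H)%:R != 0 :> R by rewrite pnatr_eq0 -lt0n rank_gt0.
have -> : mu = powR (mu ^+ rank H) (rank H)%:R^-1.
  by rewrite -powR_mulrn // -powRrM divff // powRr1.
by apply: ge0_ler_powR; rewrite ?nnegrE ?invr_ge0 ?exprn_ge0.
Qed.
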